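(* Consider the ratio-equivalent regime with proportional constant $k\in\mathbb R_{\ge0}$: $\mathbb P[c_i=ks_i]=1$ for every $i\in\mathcal N$. Then, with additive utility, reasonable workers and budget $B=\Theta(n)$, the linear pricing $p_{lin}(k)$, i.e. the common pricing paying $k s_i$ to a recruited worker $i$, is asymptotically optimal: it achieves $(1,1)$-approximation to $\mathrm{OPP}(B)$ as $n\to\infty$, i.e. there are sequences $\delta_n\to1$ ($\delta_n\le 1$) and $\gamma_n\to1$ ($\gamma_n\ge 1$) such that $p_{lin}(k)$ is $(\delta_n,\gamma_n)$-approximate to $\mathrm{OPP}(B)$.
   Context: Workers: $\mathcal N=\{1,\dots,n\}$. Worker $i$ has a random private profile $(s_i,c_i)\in\mathbb R_{\ge0}^2$ (quality, cost) with law $f_i$, known to the requester; profiles are independent across workers. Reasonable workers: there is a constant $C$ (independent of $n$) such that $\mathbb P[s_i/c_i<C]=1$ for every $i$. Pricing: a (personalized) pricing policy is $p=[p_i]_{i\in\mathcal N}$ with each $p_i:\mathbb R_{\ge0}\to\mathbb R_{\ge0}$ increasing (not necessarily strictly; constants are allowed); worker $i$, if recruited, is paid $p_i(s_i)$. A common pricing is a policy with $p_i=p$ for all $i$, for a single function $p$. Allocation process: given $p$, a budget $B$ and an arbitrary fixed ordering $\sigma$ of $\mathcal N$, workers arrive in the order $\sigma$. When worker $i$ arrives: if the remaining budget is smaller than worker $i$'s maximal possible reward (the largest possible value of $p_i(s_i)$), she is discarded ($x_i=0$); otherwise she accepts iff $p_i(s_i)\ge c_i$; if she accepts, $x_i=1$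 and $p_i(s_i)$ is deducted from the remaining budget; otherwise $x_i=0$. The law of the resulting $\vec x\in\{0,1\}^n$ (random through the profiles) is denoted $\mathcal P(p,B,\sigma)$. Utility: $u(\vec s\circ\vec x)=\sum_{i\in\mathcal N}s_ix_i$ (additive), and $U(B;p):=\mathbb E_{\vec x\sim\mathcal P(p,B,\sigma)}[u(\vec s\circ\vec x)]$. $\mathrm{OPP}(B)$ is the problem of maximizing $U(B;p)$ over all personalized pricing policies $p=[p_i]$; $p^\star(B)$ denotes a maximizer. For $0\le\delta\le1$ and $\gamma\ge1$, a common pricing $p_c$ is $(\delta,\gamma)$-approximate to $\mathrm{OPP}(B)$ if $U(\gamma B;p_c)\ge\delta\,U(B;p^\star(B))$.
   Formalization: Added assumption: under p_lin(k), every worker's maximal possible reward is at most some M_n = o(n). Without it the claim fails, e.g. c_i = s_i, B = n, s_1 = 0.6n, s_2 = n, other s_j = n^-2: linear pricing gets about 0.6n, another policy at least n. *)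

(* Defs.v *)
From HB Require Import structures.
From mathcomp Require Import all_boot all_order all_algebra perm.
From mathcomp Require Import all_classical all_reals all_analysis.
From mathcomp Require Import ess_sup_inf.

Set Implicit Arguments.
Unset Strict Implicit.
Unset Printing Implicit Defensive.

Import Order.TTheory GRing.Theory Num.Theory.
Import numFieldNormedType.Exports.

Local Open Scope classical_set_scope.
Local Open Scope ring_scope.

(* Workers are indexed by 'I_n.  The laws f_i are those of the profiles
   (quality i, cost i) under prob; every notion below depends on the profiles
   only through these laws and their independence. *)
Record crowd (R : realType) (n : nat) := Crowd {
  crowd_display : measure_display ;
  outcome : measurableType crowd_display ;
  prob : probability outcome R ;
  quality : 'I_n -> {RV prob >-> R} ;
  cost : 'I_n -> {RV prob >-> R} ;
  quality_ge0 : forall i w, 0 <= quality i w ;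
  cost_ge0 : forall i w, 0 <= cost i w ;
  profiles_independent :
    forall (J : {set 'I_n}) (A : 'I_n -> set (R * R)),
      (forall i, measurable (A i)) ->
      prob [set w | forall i, i \in J -> A i (quality i w, cost i w)] =
      (\prod_(i in J) prob [set w | A i (quality i w, cost i w)])%E
}.
Arguments prob {R n}.
Arguments quality {R n}.
Arguments cost {R n}.

Section Pricing.
Context {R : realType} {n : nat}.
Implicit Types (W : crowd R n) (p : 'I_n -> R -> R) (q : R -> R).
Implicit Types (sigma : 'S_n) (B C k : R).

(* The ratio is taken in \bar R, where s / 0 = +oo for s > 0 and 0 / 0 = 0. *)
Definition reasonable W C : Prop :=
  forall i, prob W [set w | ((quality W i w)%:E / (cost W i w)%:E < C%:E)%E]
            = 1%E.

Definition ratio_equivalent W k : Prop :=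
  forall i, prob W [set w | cost W i w = k * quality W i w] = 1%E.

(* Only the values on nonnegative reals matter. *)
Definition pricing_function q : Prop :=
  (forall x, 0 <= x -> 0 <= q x) /\
  (forall x y, 0 <= x -> x <= y -> q x <= q y).

Definition pricing_policy p : Prop := forall i, pricing_function (p i).

Definition common_pricing q : 'I_n -> R -> R := fun=> q.

Definition p_lin k : R -> R := fun x => k * x.

(* The largest possible value of p_i(s_i), up to events of probability zero;
   it is +oo when p_i(s_i) is unbounded. *)
Definition max_reward W p (i : 'I_n) : \bar R :=
  ess_sup (prob W) (fun w => (p i (quality W i w))%:E).

(* A state is the remaining budget together with the decisions made so far. *)
Definition arrival W p (w : outcome W) (st : R * {ffun 'I_n -> bool})
    (i : 'I_n) : R * {ffun 'I_n -> bool} :=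
  if (st.1%:E < max_reward W p i)%E then st
  else if cost W i w <= p i (quality W i w) then
    (st.1 - p i (quality W i w), [ffun j => (j == i) || st.2 j])
  else st.

(* sigma j is the j-th worker to arrive. *)
Definition allocation W p B sigma (w : outcome W) : {ffun 'I_n -> bool} :=
  (foldl (arrival p w) (B, [ffun=> false]) [seq sigma j | j <- enum 'I_n]).2.

Definition utility (y : 'I_n -> R) : R := \sum_(i < n) y i.

Definition expected_utility W sigma B p : \bar R :=
  ('E_(prob W)[fun w => utility
     (fun i => quality W i w * (allocation p B sigma w i)%:R)%R])%E.

Definition OPP W sigma B : \bar R :=
  ereal_sup [set expected_utility W sigma B p | p in pricing_policy].

Definition OPP_maximizer W sigma B p : Prop :=
  pricing_policy p /\
  forall p', pricing_policy p' ->
    (expected_utility W sigma B p' <= expected_utility W sigma B p)%E.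

Lemma OPP_maximizerE W sigma B p : OPP_maximizer W sigma B p ->
  OPP W sigma B = expected_utility W sigma B p.
Proof.
move=> [pp pmax]; apply/eqP; rewrite eq_le; apply/andP; split.
  by apply: ge_ereal_sup => _ [p' pp' <-]; exact: pmax.
by apply: ereal_sup_ubound; exists p.
Qed.

(* Using the supremum OPP rather than the utility of a maximizer avoids
   presupposing that a maximizer exists. *)
Definition approximate W sigma B (delta gamma : R) q : Prop :=
  [/\ 0 <= delta <= 1, 1 <= gamma, pricing_function q &
      (delta%:E * OPP W sigma B <=
       expected_utility W sigma (gamma * B) (common_pricing q))%E].

End Pricing.

(* Main.v *)
(* When cost = k * quality, every accepted worker must be paid at least
   k times her quality, so under any policy k * utility is at most the budget.
   Linear pricing pays exactly that and every offer is accepted; hence it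
   either recruits everybody or stops only when less than one maximal reward
   is left.  Enlarging the budget from B to B + M = (1 + o(1)) B therefore makes
   it beat every policy with budget B on almost every outcome. *)
Require Import Defs.
From HB Require Import structures.
From mathcomp Require Import all_boot all_order all_algebra perm.
From mathcomp Require Import all_classical all_reals all_analysis.
From mathcomp Require Import measurable_realfun ess_sup_inf lra.

Set Implicit Arguments.
Unset Strict Implicit.
Unset Printing Implicit Defensive.

Import Order.TTheory GRing.Theory Num.Theory.
Import numFieldNormedType.Exports.

Local Open Scope classical_set_scope.
Local Open Scope ring_scope.

Section LowerIntegral.
Import HBNNSimple.

(* No measurability is needed: the integral of a nonnegative function is a
   supremum over the simple functions below it, and these can be cut off on a
   null set. *)
Lemma ge0_ae_le_integral d (T : measurableType d) (R : realType)
    (mu : {measure set T -> \bar R}) (f g : T -> \bar R) :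
  (forall x, 0 <= f x)%E -> (forall x, 0 <= g x)%E ->
  (\forall x \ae mu, (f x <= g x)%E) ->
  (\int[mu]_x f x <= \int[mu]_x g x)%E.
Proof.
move=> f0 g0 [N [mN muN0 fgN]].
rewrite [leLHS]ge0_integralTE// [leRHS]ge0_integralTE//.
apply: ge_ereal_sup => _ /= [h hf <-]; apply: ereal_sup_ubound => /=.
exists (proj_nnsfun h (measurableC mN)).
  move=> x; rewrite -mrestrict patchE; case: ifPn => [|_]; last exact: g0.
  rewrite inE => NNx; apply: le_trans (hf x) _.
  by apply: contrapT => nfg; exact/NNx/fgN.
rewrite -mrestrict -integral_nnsfun; last exact: measurableC.
rewrite -integralT_nnsfun -setTD -ge0_negligible_integral//.
  exact/measurable_EFinP.
by move=> x _; rewrite lee_fin.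
Qed.

End LowerIntegral.

Section Pathwise.
Context {R : realType} {n : nat} (W : crowd R n).
Implicit Types (p : 'I_n -> R -> R) (sigma : 'S_n) (B k : R).

Definition realized_utility p B sigma (w : outcome W) : R :=
  utility (fun i => quality W i w * (allocation p B sigma w i)%:R).

Let gain (w : outcome W) (x : {ffun 'I_n -> bool}) : R :=
  \sum_i quality W i w * (x i)%:R.

Let gain_add w (x : {ffun 'I_n -> bool}) i :
  gain w [ffun j => (j == i) || x j] =
  gain w x + (if x i then 0 else quality W i w).
Proof.
rewrite /gain (bigD1 i)//= [in RHS](bigD1 i)//= ffunE eqxx/= mulr1.
rewrite (eq_bigr (fun j => quality W j w * (x j)%:R)); last first.
  by move=> j ji; rewrite ffunE (negbTE ji).
by case: (x i); rewrite ?mulr1 ?mulr0 ?addr0// add0r addrC.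
Qed.

Lemma realized_utility_ge0 p B sigma w : 0 <= realized_utility p B sigma w.
Proof. by apply: sumr_ge0 => i _; rewrite mulr_ge0// quality_ge0. Qed.

(** Each accepted offer pays at least the cost [k * quality], so [k] times the gain never exceeds
    the money spent. The discard test keeps the remaining budget nonnegative, because [pmax] bounds
    every payment by the maximal reward. *)
Lemma realized_utility_le_budget p B sigma k w : 0 <= k -> 0 <= B ->
  (forall i, cost W i w = k * quality W i w) ->
  (forall i, ((p i (quality W i w))%:E <= max_reward W p i)%E) ->
  k * realized_utility p B sigma w <= B.
Proof.
move=> k0 B0 cE pmax.
suff [H0 HB] : let st := foldl (arrival p w) (B, [ffun=> false])
      [seq sigma j | j <- enum 'I_n] in
    0 <= st.1 /\ k * gain w st.2 <= B - st.1.
  by apply: (le_trans HB); rewrite gerBl.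
elim/last_ind: [seq _ | _ <- _] => [|s i]/=.
  split=> //; rewrite /gain big1 ?mulr0 ?subrr// => i _.
  by rewrite ffunE mulr0.
rewrite foldl_rcons; move: (foldl _ _ s) => [b x] /= [b0 gB].
rewrite /arrival/=; case: ifPn => [//|]; rewrite -leNgt => mb.
case: ifPn => //=; rewrite cE => pc.
have := le_trans (pmax i) mb; rewrite lee_fin => pb.
split; first by rewrite subr_ge0.
rewrite gain_add mulrDr.
(* The list is arbitrary here, so worker [i] may already be recruited and add nothing; an inequality
   is enough. *)
have : k * (if x i then 0 else quality W i w) <= k * quality W i w.
  by case: (x i); rewrite ?mulr0// mulr_ge0// quality_ge0.
move=> ?; lra.
Qed.

(** Every offer pays exactly the cost, hence is accepted, and [k] times the gain equals the money
    spent. A worker is missed only when less than her maximal reward, hence less than [M], is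
    left. *)
Lemma p_lin_exhausts_budget B (M : R) sigma k w : 0 <= k ->
  (forall i, cost W i w = k * quality W i w) ->
  (forall i, (max_reward W (common_pricing (p_lin k)) i <= M%:E)%E) ->
  B - M < k * realized_utility (common_pricing (p_lin k)) B sigma w \/
  forall i, allocation (common_pricing (p_lin k)) B sigma w i.
Proof.
move=> k0 cE maxM; rewrite /realized_utility /allocation.
set l := [seq _ | _ <- _].
have memT i : i \in l.
  by apply/mapP; exists (sigma^-1%g i); rewrite ?mem_enum// permKV.
(* Distinct arrivals make the invariant an equality: all recruits are among the earlier arrivals, so
   each newcomer adds her full quality. *)
have ul : uniq l by rewrite map_inj_uniq ?enum_uniq//; exact: perm_inj.
suff [_ _ [|allx]] : let st :=
    foldl (arrival (common_pricing (p_lin k)) w) (B, [ffun=> false]) l in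
    [/\ B - st.1 = k * gain w st.2, forall j, st.2 j -> j \in l &
        B - M < k * gain w st.2 \/ forall j, j \in l -> st.2 j].
- by left.
- by right=> i; exact: allx.
elim/last_ind: l ul {memT} => [_|s i IH]/=.
  split; last by right.
    rewrite /gain big1 ?mulr0 ?subrr// => i _.
    by rewrite ffunE mulr0.
  by move=> i; rewrite ffunE.
rewrite rcons_uniq => /andP[iNs /IH].
rewrite foldl_rcons; move: (foldl _ _ s) => [b x] /= [gE xs sx].
rewrite /arrival/=; case: ifPn => [bm|_].
  split=> //; first by move=> j /xs; rewrite mem_rcons inE orbC => ->.
  left; have := lt_le_trans bm (maxM i); rewrite lte_fin => ?; lra.
rewrite cE lexx /=.
have xi : x i = false by apply: contraNF iNs => /xs.
have qk : 0 <= k * quality W i w by rewrite mulr_ge0// quality_ge0.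
split.
- rewrite gain_add xi mulrDr -gE /common_pricing /p_lin; lra.
- move=> j; rewrite ffunE mem_rcons inE => /orP[->//|/xs ->].
  by rewrite orbT.
- rewrite gain_add xi mulrDr; case: sx => [?|sx]; [left; lra|right].
  move=> j; rewrite mem_rcons inE ffunE => /orP[->//|/sx ->].
  by rewrite orbT.
Qed.

Lemma realized_utility_le_p_lin p B (B' M : R) sigma k w : 0 <= k -> 0 <= B ->
  B + M <= B' ->
  (forall i, cost W i w = k * quality W i w) ->
  (forall i, ((p i (quality W i w))%:E <= max_reward W p i)%E) ->
  (forall i, (max_reward W (common_pricing (p_lin k)) i <= M%:E)%E) ->
  realized_utility p B sigma w <=
  realized_utility (common_pricing (p_lin k)) B' sigma w.
Proof.
move=> k0 B0 BM cE pmax maxM.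
have [spent|all_in] := p_lin_exhausts_budget B' sigma k0 cE maxM.
  (* Since [k] may be 0, there is no division: if linear pricing gained less than [p], then [k]
     times its gain would be at most [B], yet it exceeds [B' - M], which is at least [B]. *)
  rewrite leNgt; apply/negP => /ltW /(ler_wpM2l k0).
  have := realized_utility_le_budget sigma k0 B0 cE pmax.
  by move=> ? ?; lra.
apply: ler_sum => i _; rewrite all_in mulr1.
by case: (allocation _ _ _ _ _); rewrite ?mulr1// mulr0 quality_ge0.
Qed.

End Pathwise.

Section Expectation.
Context {R : realType} {n : nat} (W : crowd R n).

Lemma expected_utilityE sigma B p :
  (expected_utility W sigma B p =
   \int[prob W]_w (realized_utility p B sigma w)%:E)%E.
Proof. by rewrite /expected_utility unlock. Qed.

Lemma expected_utility_ge0 sigma B p : (0 <= expected_utility W sigma B p)%E.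
Proof.
rewrite expected_utilityE integral_ge0// => w _.
by rewrite lee_fin realized_utility_ge0.
Qed.

Lemma ratio_equivalent_ae k : ratio_equivalent W k ->
  \forall w \ae prob W, forall i, cost W i w = k * quality W i w.
Proof.
move=> Wk; apply: filter_forall => i.
have mE : measurable [set w | cost W i w = k * quality W i w].
  rewrite -[X in measurable X]setTI (_ : mkset _ =
      (fun w => cost W i w == k * quality W i w) @^-1` [set true]).
    apply: measurable_fun_eqr => //.
    exact: measurable_funM.
  by apply/seteqP; split=> w /eqP.
exists (~` [set w | cost W i w = k * quality W i w]); split => //.
  exact: measurableC.
by rewrite probability_setC// Wk subee.
Qed.

(** The pathwise comparison rests on the cost relation and on payments being bounded by their
    essential suprema; both hold almost surely, for all of the finitely many workers at once. *)
Lemma OPP_le_p_lin (k B B' M : R) sigma : 0 <= k -> 0 <= B ->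
  B + M <= B' -> ratio_equivalent W k ->
  (forall i, (max_reward W (common_pricing (p_lin k)) i <= M%:E)%E) ->
  (OPP W sigma B <= expected_utility W sigma B' (common_pricing (p_lin k)))%E.
Proof.
move=> k0 B0 BM Wk maxM; apply: ge_ereal_sup => _ [p _ <-].
rewrite !expected_utilityE; apply: ge0_ae_le_integral => [w|w|].
- by rewrite lee_fin realized_utility_ge0.
- by rewrite lee_fin realized_utility_ge0.
have pmax : \forall w \ae prob W, forall i,
    ((p i (quality W i w))%:E <= max_reward W p i)%E.
  by apply: filter_forall => i; exact: ess_sup_ge.
apply: filterS2 (ratio_equivalent_ae Wk) pmax => w cE pmax.
by rewrite lee_fin; exact: realized_utility_le_p_lin maxM.
Qed.

End Expectation.

Lemma pricing_function_p_lin (R : realType) (k : R) :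
  0 <= k -> pricing_function (p_lin k).
Proof.
by move=> k0; split=> [x x0|x y _ xy]; [exact: mulr_ge0|exact: ler_wpM2l].
Qed.

Lemma Theta_nat_near_ge (R : realType) (B : nat -> R) :
  (forall n, 0 <= B n) ->
  (B : nat -> R^o) =Theta_\oo (fun n : nat => n%:R : R^o) ->
  exists2 a : R, 0 < a & \forall n \near \oo, 0 < B n /\ a * n%:R <= B n.
Proof.
move=> B0; rewrite eqThetaE qualifE => /asboolP[[a b] /= /andP[a0 _] BT].
exists a => //; near=> n.
have [+ _] : a * `|n%:R : R^o| <= `|B n : R^o| /\ `|B n : R^o| <= b * `|n%:R : R^o|.
  by near: n.
rewrite !ger0_norm// => aB; split=> //; apply: lt_le_trans aB.
by rewrite mulr_gt0// ltr0n; near: n; exact: nbhs_infty_gt.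
Unshelve. all: by end_near. Qed.

Lemma littleo_div_Theta_cvg0 (R : realType) (B M : nat -> R) :
  (forall n, 0 <= B n) ->
  (B : nat -> R^o) =Theta_\oo (fun n : nat => n%:R : R^o) ->
  (M : nat -> R^o) =o_\oo (fun n : nat => n%:R : R^o) ->
  `|M n| / B n @[n --> \oo] --> (0 : R).
Proof.
move=> B0 /(Theta_nat_near_ge B0)[a a0 aB] /eqoP Mo.
apply/cvgr0Pnorm_le => e e0.
(* The tolerance for [M n] relative to [n] is [e * a]: as [a * n <= B n] eventually, it yields
   [|M n| <= e * B n]. *)
have ea0 : 0 < e * a by rewrite mulr_gt0.
have {}Mo := Mo _ ea0; near=> n.
have [Bn aBn] : 0 < B n /\ a * n%:R <= B n by near: n.
have : `|M n : R^o| <= e * a * `|n%:R : R^o| by near: n.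
rewrite (ger0_norm (ler0n _ _)) => Mn.
rewrite ger0_norm ?divr_ge0// ler_pdivrMr// (le_trans Mn)// -mulrA.
by rewrite ler_pM2l.
Unshelve. all: by end_near. Qed.

Theorem proposition1 (R : realType) (k C : R)
    (W : forall n : nat, crowd R n) (sigma : forall n : nat, 'S_n)
    (B M : nat -> R)
    (k_ge0 : 0 <= k)
    (W_ratio : forall n : nat, ratio_equivalent (W n) k)
    (W_reasonable : forall n : nat, reasonable (W n) C)
    (B_ge0 : forall n : nat, 0 <= B n)
    (B_Theta : (B : nat -> R^o) =Theta_\oo (fun n : nat => n%:R : R^o))
    (M_small : (M : nat -> R^o) =o_\oo (fun n : nat => n%:R : R^o))
    (max_reward_le : forall (n : nat) (i : 'I_n),
      (max_reward (W n) (common_pricing (p_lin k)) i <= (M n)%:E)%E) :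
  exists delta gamma : nat -> R,
    [/\ delta n @[n --> \oo] --> (1 : R),
        gamma n @[n --> \oo] --> (1 : R) &
        forall n : nat,
          approximate (W n) (sigma n) (B n) (delta n) (gamma n) (p_lin k)].
Proof.
(* No factor gamma enlarges an empty budget, so delta is 0 for the finitely
   many n with B n = 0. *)
exists (fun n => (B n != 0)%:R), (fun n => 1 + `|M n| / B n); split.
- have [a _ aB] := Theta_nat_near_ge B_ge0 B_Theta.
  apply: cvg_near_cst; apply: filterS aB => n [/lt0r_neq0 Bn _].
  by rewrite Bn.
- rewrite -[X in _ --> X]addr0; apply: cvgD; first exact: cvg_cst.
  exact: littleo_div_Theta_cvg0.
move=> n; split.
- by case: (B n != 0); rewrite ?lexx ler01.
- by rewrite lerDl divr_ge0.
- exact: pricing_function_p_lin.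
have [->|B_neq0] := eqVneq (B n) 0; first by rewrite mul0e expected_utility_ge0.
rewrite mul1e; apply: OPP_le_p_lin (max_reward_le n) => //.
(* The choice of [gamma] makes the enlarged budget exactly [B n + |M n|]; the absolute value keeps
   [gamma n >= 1] whatever the sign of [M n]. *)
by rewrite mulrDl mul1r divfK// lerD2l ler_norm.
Qed.
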